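(* Let $K$ be a field and $q\ge2$. Let $\mathcal{A}$ and $\mathcal{B}$ be D$_q$ subalgebras of $\mathrm{M}_n(K)$ of types $(n_1,n_2,\ldots,n_q)$ and $(\ell_1,\ell_2,\ldots,\ell_q)$, respectively, with max-dim db's, and let $\mathcal{A}_{ii}$ and $\mathcal{B}_{ii}$, $i=1,\ldots,q$, be their diagonal blocks. If $\mathcal{A}$ and $\mathcal{B}$ are isomorphic (as $K$-algebras), then the $q$-tuples $(n_1,n_2,\ldots,n_q)$ and $(\ell_1,\ell_2,\ldots,\ell_q)$ are equal and the algebras $\mathcal{A}_{ii}$ and $\mathcal{B}_{ii}$ are isomorphic for every $i=1,2,\ldots,q$.
   Context: All algebras are associative and unital over the field $K$; a subalgebra of $\mathrm{M}_m(K)$ is a (unital) $K$-subalgebra. $[x,y]=xy-yx$. An algebra is D$_q$ if it satisfies the identity $[x_1,y_1][x_2,y_2]\cdots[x_q,y_q]=0$. For positive integers $n_1,\ldots,n_q$ ($q\ge 2$) with $n_1+\cdots+n_q=n$, view matrices in $\mathrm{M}_n(K)$ as $q\times q$ block matrices whose $(i,j)$ block has size $n_i\times n_j$. A subalgebra $\mathcal{A}$ of $\mathrm{M}_n(K)$ is of type $(n_1,\ldots,n_q)$ if there are subalgebras $\mathcal{A}_{ii}$ of $\mathrm{M}_{n_i}(K)$, $i=1,\ldots,q$ (its diagonal blocks), such that $\mathcal{A}$ consists of exactly all block matrices whose $(i,i)$ block lies in $\mathcal{A}_{ii}$ (independently for each $i$), whose $(i,j)$ block is an arbitrary element of $\mathrm{M}_{n_i\times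 n_j}(K)$ for $i<j$, and whose $(i,j)$ block is zero for $i>j$. It is a D$_q$ subalgebra of $\mathrm{M}_n(K)$ of type $(n_1,\ldots,n_q)$ with max-dim db's if, moreover, every $\mathcal{A}_{ii}$ is a commutative subalgebra of $\mathrm{M}_{n_i}(K)$ with maximum dimension among commutative subalgebras of $\mathrm{M}_{n_i}(K)$ (equal to $\lfloor n_i^2/4\rfloor+1$). (Such an algebra automatically satisfies the D$_q$ identity.) *)

(* Defs.v *)
From mathcomp Require Import all_boot all_order all_algebra.

Set Implicit Arguments.
Unset Strict Implicit.
Unset Printing Implicit Defensive.

Import GRing.Theory.
Local Open Scope ring_scope.

(* Unital K-subalgebras of M_m(K). The falgType theory ({aspace _}) only       *)
(* applies to 'M_m.+1, and its subspaces need not contain the ambient unit.   *)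
Record subalg (K : fieldType) (m : nat) := Subalg {
  subalg_vs :> {vspace 'M[K]_m};
  subalg1 : 1%:M \in subalg_vs;
  subalgM : {in subalg_vs &, forall x y, x *m y \in subalg_vs}
}.

Section Subalgebras.

Variable K : fieldType.

Definition subalg_one m (A : subalg K m) : subvs_of A := Subvs (subalg1 A).

Definition subalg_mul m (A : subalg K m) (u v : subvs_of A) : subvs_of A :=
  Subvs (subalgM (subvsP u) (subvsP v)).

Definition alg_isomorphic m1 m2 (A : subalg K m1) (B : subalg K m2) : Prop :=
  exists f : {linear subvs_of A -> subvs_of B},
    [/\ bijective f,
        f (subalg_one A) = subalg_one B
      & forall u v, f (subalg_mul u v) = subalg_mul (f u) (f v)].

Definition comm_subalg m (A : subalg K m) : Prop :=
  {in A &, forall x y, x *m y = y *m x}.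

Definition max_dim_comm_subalg m (A : subalg K m) : Prop :=
  comm_subalg A /\
  forall C : subalg K m, comm_subalg C -> (\dim C <= \dim A)%N.

Definition subalg_of_type n q (t : q.-tuple nat) (A : subalg K n)
    (D : forall i : 'I_q, subalg K (tnth t i)) : Prop :=
  (forall i : 'I_q, 0 < tnth t i)%N /\
  exists e : (\sum_(i < q) tnth t i)%N = n,
    forall M : 'M[K]_n,
      let M' := castmx (esym e, esym e) M in
      M \in A <->
        (forall i : 'I_q, submxblock M' i i \in D i) /\
        (forall i j : 'I_q, (j < i)%N -> submxblock M' i j = 0).

(* The identity [x1,y1]...[xq,yq] = 0 is not required separately: it follows  *)
(* from block triangularity and the commutativity of the q diagonal blocks.   *)
Definition Dq_subalg_of_type_max_dim_db n q (t : q.-tuple nat)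
    (A : subalg K n) (D : forall i : 'I_q, subalg K (tnth t i)) : Prop :=
  subalg_of_type A D /\ forall i : 'I_q, max_dim_comm_subalg (D i).

End Subalgebras.

(* Main.v *)
(* Write N for the ideal of strictly block upper triangular matrices. It is   *)
(* generated by the commutators of A, and for a in A the product              *)
(* N^(i-1) a N^(q-i) only sees the (1,i), (i,i) and (i,q) blocks, so it       *)
(* vanishes iff a_ii = 0. Hence A_ii is the quotient of A by an ideal defined *)
(* by the ring structure alone, and isomorphic algebras have isomorphic       *)
(* diagonal blocks. The maximal dimension of a commutative subalgebra of M_m  *)
(* is strictly increasing in m (add a 1x1 diagonal block), so the dimension   *)
(* of A_ii determines n_i. Powers of N are replaced by products of            *)
(* commutators; block indices start at 0 in the code.                         *)
From HB Require Import structures.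
Require Import Defs.
From mathcomp Require Import all_boot all_order all_algebra.

Set Implicit Arguments.
Unset Strict Implicit.
Unset Printing Implicit Defensive.

Import GRing.Theory.
Local Open Scope ring_scope.

(** [diag_block_kills] carries the argument: with [i] commutators on the left and [q.-1 - i] on the
    right, triangularity leaves only the [i]-th diagonal block of [a], and suitable commutators
    recover each of its entries. This makes [D i] a [split_quotient] of [A], so [split_quotient_iso]
    matches the diagonal blocks; [max_dim_comm_subalg_size] then reads their sizes off their
    dimensions. *)

Section Morphisms.

Variable K : fieldType.

Lemma alg_isomorphic_intro m1 m2 (A : subalg K m1) (B : subalg K m2)
    (f : subvs_of A -> subvs_of B) :
  linear f -> bijective f -> f (subalg_one A) = subalg_one B ->
  (forall u v, f (subalg_mul u v) = subalg_mul (f u) (f v)) ->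
  alg_isomorphic A B.
Proof.
move=> lin_f bij_f f1 fM.
pose L := GRing.isLinear.Build K (subvs_of A) (subvs_of B) *:%R f lin_f.
by exists (HB.pack_for {linear subvs_of A -> subvs_of B} f L).
Qed.

Lemma subalg_mulBr m (A : subalg K m) (u v w : subvs_of A) :
  subalg_mul u (v - w) = subalg_mul u v - subalg_mul u w.
Proof. by apply/val_inj; rewrite /= mulmxBr. Qed.

Inductive comm_prod m (A : subalg K m) : nat -> subvs_of A -> Prop :=
| comm_prod0 : comm_prod 0 (subalg_one A)
| comm_prodS k x u v : comm_prod k x ->
    comm_prod k.+1 (subalg_mul x (subalg_mul u v - subalg_mul v u)).

(** By associativity; [col_reach] builds its products from right to left. *)
Lemma comm_prodSl m (A : subalg K m) k (x u v : subvs_of A) :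
  comm_prod k x ->
  comm_prod k.+1 (subalg_mul (subalg_mul u v - subalg_mul v u) x).
Proof.
elim: k x / => [|k x u' v' _ IH].
  have -> : subalg_mul (subalg_mul u v - subalg_mul v u) (subalg_one A) =
    subalg_mul (subalg_one A) (subalg_mul u v - subalg_mul v u).
    by apply/val_inj; rewrite /= mul1mx mulmx1.
  exact/comm_prodS/comm_prod0.
have -> (a b c : subvs_of A) :
    subalg_mul a (subalg_mul b c) = subalg_mul (subalg_mul a b) c.
  by apply/val_inj; rewrite /= mulmxA.
exact: comm_prodS.
Qed.

Lemma comm_prod_morph m1 m2 (A : subalg K m1) (B : subalg K m2)
    (f : {linear subvs_of A -> subvs_of B}) k x :
  f (subalg_one A) = subalg_one B ->
  (forall u v, f (subalg_mul u v) = subalg_mul (f u) (f v)) ->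
  comm_prod k x -> comm_prod k (f x).
Proof.
move=> f1 fM; elim: k x / => [|k x u v _ IH]; first by rewrite f1; left.
by rewrite fM linearB !fM; right.
Qed.

Definition comm_prod_kills m (A : subalg K m) i j (a : subvs_of A) :=
  forall x y, comm_prod i x -> comm_prod j y ->
  subalg_mul (subalg_mul x a) y = 0.

Lemma comm_prod_kills_morph m1 m2 (A : subalg K m1) (B : subalg K m2)
    (f : {linear subvs_of A -> subvs_of B}) (g : subvs_of B -> subvs_of A)
    i j a :
  cancel f g -> cancel g f -> f (subalg_one A) = subalg_one B ->
  (forall u v, f (subalg_mul u v) = subalg_mul (f u) (f v)) ->
  comm_prod_kills i j (f a) -> comm_prod_kills i j a.
Proof.
move=> fK gK f1 fM kill x y cx cy; apply: (can_inj fK).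
by rewrite !fM linear0; apply: kill; apply: comm_prod_morph.
Qed.

(* A quotient of A by [comm_prod_kills i j], presented through a projection   *)
(* with a multiplicative but non-unital section.                              *)
Definition split_quotient m d (A : subalg K m) (D : subalg K d) i j :=
  exists (p : {linear subvs_of A -> subvs_of D})
         (s : {linear subvs_of D -> subvs_of A}),
    [/\ cancel s p, p (subalg_one A) = subalg_one D,
        forall u v, p (subalg_mul u v) = subalg_mul (p u) (p v),
        forall u v, s (subalg_mul u v) = subalg_mul (s u) (s v)
      & forall a, p a = 0 <-> comm_prod_kills i j a].

(** Both kernels are cut out by the same intrinsic condition, so [f] and its inverse exchange them.
    Hence [p' \o f \o s] is the induced map of quotients. *)
Lemma split_quotient_iso m1 m2 d1 d2 (A : subalg K m1) (B : subalg K m2)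
    (D : subalg K d1) (E : subalg K d2) i j :
  alg_isomorphic A B -> split_quotient A D i j -> split_quotient B E i j ->
  alg_isomorphic D E.
Proof.
move=> [f [[g fK gK] f1 fM]] [p [s [sK p1 pM sM pP]]].
move=> [p' [s' [sK' p1' pM' sM' pP']]].
have gL : linear g.
  by move=> c u v; apply: (can_inj fK); rewrite linearP !gK.
pose L := GRing.isLinear.Build K (subvs_of B) (subvs_of A) *:%R g gL.
pose G := HB.pack_for {linear subvs_of B -> subvs_of A} g L.
have g1 : G (subalg_one B) = subalg_one A by rewrite /= -f1 fK.
have gM u v : G (subalg_mul u v) = subalg_mul (G u) (G v).
  by apply: (can_inj fK); rewrite fM /= !gK.
have eqA u v : p u = p v -> p' (f u) = p' (f v).
  move=> /eqP; rewrite -subr_eq0 -linearB => /eqP/pP kill; apply/eqP.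
  rewrite -subr_eq0 -!linearB; apply/eqP/pP'.
  by apply: (@comm_prod_kills_morph _ _ _ _ G f) => //; rewrite /= fK.
have eqB u v : p' u = p' v -> p (g u) = p (g v).
  move=> /eqP; rewrite -subr_eq0 -linearB => /eqP/pP' kill; apply/eqP.
  rewrite -subr_eq0 -linearB -[g u - g v](linearB G); apply/eqP/pP.
  by apply: (@comm_prod_kills_morph _ _ _ _ f g) => //; rewrite /= gK.
apply: (@alg_isomorphic_intro _ _ _ _ (p' \o f \o s)).
- by move=> c u v; rewrite /= !linearP.
- exists (p \o g \o s') => u /=.
    by rewrite (eqB _ (f (s u))) ?fK ?sK ?sK'.
  by rewrite (eqA _ (g (s' u))) ?gK ?sK ?sK'.
(* Although [s] need not preserve the unit, [s 1] and [1] agree modulo the kernel of [p]. *)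
- by rewrite /= (eqA _ (subalg_one A)) ?sK ?f1.
- by move=> u v; rewrite /= sM fM pM'.
Qed.

(** * Dimension determines the matrix size *)

Lemma alg_isomorphic_dim m1 m2 (A : subalg K m1) (B : subalg K m2) :
  alg_isomorphic A B -> \dim A = \dim B.
Proof.
move=> [f [[g fK gK] _ _]].
have kf : lker (linfun f) == 0%VS.
  by apply/lker0P => u v; rewrite !lfunE; apply: (can_inj fK).
have imf : limg (linfun f) = fullv.
  apply/eqP; rewrite eqEsubv subvf; apply/subvP => u _.
  by apply/memv_imgP; exists (g u); rewrite ?memvf ?lfunE /= ?gK.
have dimE m (C : subalg K m) : \dim {:subvs_of C} = \dim C by rewrite dimvf.
by rewrite -!dimE -imf limg_dim_eq // (eqP kf) capv0.
Qed.

(** The witness is [D] plus the scalars of a second diagonal block of size [k.+1]. Allowing any [k]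
    reaches every larger size in one step. *)
Lemma comm_subalg_extend m k (D : subalg K m) : comm_subalg D ->
  exists2 C : subalg K (m + k.+1), comm_subalg C & (\dim D < \dim C)%N.
Proof.
move=> commD.
pose iota (a : 'M[K]_m) : 'M[K]_(m + k.+1) := block_mx a 0 0 0.
have iotaL : linear iota.
  by move=> c a b; rewrite /iota scale_block_mx add_block_mx !scaler0 !addr0.
pose L := GRing.isLinear.Build K 'M[K]_m 'M[K]_(m + k.+1) *:%R iota iotaL.
pose I := linfun (HB.pack_for {linear 'M[K]_m -> 'M[K]_(m + k.+1)} iota L).
have IE a : I a = iota a by rewrite lfunE.
pose E : 'M[K]_(m + k.+1) := block_mx 0 0 0 1%:M.
have memC M : reflect (exists2 a, a \in D & exists b, M = block_mx a 0 0 b%:M)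
    (M \in (I @: D + <[E]>)%VS).
  have blkE a b : I a + b *: E = block_mx a 0 0 b%:M.
    by rewrite IE scale_block_mx add_block_mx !scaler0 !addr0 !add0r
      scale_scalar_mx mulr1.
  apply: (iffP memv_addP) => [[_ /memv_imgP[a Da ->] [_ /vlineP[b ->] ->]]|].
    by exists a => //; exists b.
  move=> [a Da [b ->]]; exists (I a); first exact: memv_img.
  by exists (b *: E); rewrite ?memvZ ?memv_line.
have C1 : 1%:M \in (I @: D + <[E]>)%VS.
  by apply/memC; exists 1%:M; [exact: subalg1 | exists 1; rewrite scalar_mx_block].
have CM : {in (I @: D + <[E]>)%VS &, forall x y,
    x *m y \in (I @: D + <[E]>)%VS}.
  move=> _ _ /memC[a Da [b ->]] /memC[a' Da' [b' ->]]; apply/memC.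
  exists (a *m a'); [exact: subalgM | exists (b * b')].
  by rewrite mulmx_block !mulmx0 !mul0mx !addr0 !add0r scalar_mxM.
exists (Subalg C1 CM) => /=.
  move=> _ _ /memC[a Da [b ->]] /memC[a' Da' [b' ->]].
  rewrite !mulmx_block !mulmx0 !mul0mx !addr0 !add0r -!scalar_mxM mulrC.
  by rewrite commD.
have <- : \dim (I @: D) = \dim D.
  apply: limg_dim_eq; apply/eqP; rewrite -subv0; apply/subvP => a.
  rewrite memv_cap memv_ker IE memv0 => /andP[_ /eqP].
  by rewrite -block_mx0 => /eq_block_mx[-> _ _ _].
(* Equal dimensions would put [E] in the image of [D], whose lower right corner is zero. *)
rewrite ltnNge; apply/negP => le_dim.
have /eqP eqC : (I @: D == I @: D + <[E]>)%VS by rewrite eqEdim addvSl.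
have : E \in (I @: D)%VS by rewrite eqC (subvP (addvSr _ _)) ?memv_line.
move=> /memv_imgP[a _]; rewrite IE => /eq_block_mx[_ _ _ /eqP].
by rewrite oner_eq0.
Qed.

Lemma max_dim_comm_subalg_size m1 m2 (D : subalg K m1) (E : subalg K m2) :
  max_dim_comm_subalg D -> max_dim_comm_subalg E -> \dim D = \dim E -> m1 = m2.
Proof.
suff lt_dim a b (F : subalg K a) (G : subalg K b) : max_dim_comm_subalg F ->
    max_dim_comm_subalg G -> (a < b)%N -> (\dim F < \dim G)%N.
  move=> mD mE eq_dim; case: (ltngtP m1 m2) => // [lt12|lt21].
    by have := lt_dim _ _ _ _ mD mE lt12; rewrite eq_dim ltnn.
  by have := lt_dim _ _ _ _ mE mD lt21; rewrite eq_dim ltnn.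
move=> [commF _] [commG maxG] lt_ab.
have [k def_b] : exists k, b = (a + k.+1)%N.
  by exists (b - a.+1)%N; rewrite addnS -addSn subnKC.
subst b; have [C commC lt_dim] := comm_subalg_extend k commF.
exact: leq_trans lt_dim (maxG C commC).
Qed.

End Morphisms.

(** * Diagonal blocks of a block triangular algebra *)

Section BlockTriangular.

Variables (K : fieldType) (q : nat) (d : 'I_q -> nat).
Variables (A : subalg K (\sum_i d i)) (D : forall i, subalg K (d i)).
Hypothesis d_gt0 : forall i, (0 < d i)%N.
Hypothesis commD : forall i, comm_subalg (D i).
Hypothesis memA : forall M, M \in A <->
  (forall i, submxblock M i i \in D i) /\
  (forall i j : 'I_q, (j < i)%N -> submxblock M i j = 0).

(** The coordinate projections onto the blocks reduce block extraction and insertion to plain matrix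
    products. *)
Let P i : 'M[K]_(d i, \sum_i d i) := rowsub (tagnat.Rank i) 1%:M.

Let blkE M i j : submxblock M i j = P i *m M *m (P j)^T.
Proof.
rewrite /P mul_rowsub_mx mul1mx; apply/matrixP => r c; rewrite !mxE.
rewrite (bigD1 (tagnat.Rank j c)) //= !mxE eqxx mulr1 [X in _ + X]big1 ?addr0 // => k.
by rewrite !mxE eq_sym => /negPf ->; rewrite mulr0.
Qed.

Let blkM (M N : 'M[K]_(\sum_i d i)) i k :
  submxblock (M *m N) i k = \sum_j submxblock M i j *m submxblock N j k.
Proof.
by rewrite -{1}(submxblockK M) -{1}(submxblockK N) mul_mxblock mxblockK.
Qed.

Let P_orth i j : i != j -> P i *m (P j)^T = 0.
Proof.
move=> neq_ij; have := blkE 1%:M i j; rewrite mulmx1 => <-; apply/matrixP => r c.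
by rewrite !mxE -val_eqE /= tagnat.eq_Rank (negPf neq_ij).
Qed.

Let P_unit i : P i *m (P i)^T = 1%:M.
Proof.
have := blkE 1%:M i i; rewrite mulmx1 => <-; apply/matrixP => r c.
by rewrite !mxE -val_eqE /= tagnat.eq_Rank eqxx.
Qed.

Let emb i j (X : 'M[K]_(d i, d j)) := (P i)^T *m X *m P j.

Let emb_blk i j X : submxblock (@emb i j X) i j = X.
Proof. by rewrite blkE /emb !mulmxA P_unit mul1mx -mulmxA P_unit mulmx1. Qed.

Let emb_blk0 i j X k l : (k != i) || (l != j) ->
  submxblock (@emb i j X) k l = 0.
Proof.
rewrite blkE /emb !mulmxA => /orP[/P_orth ->|]; first by rewrite !mul0mx.
by rewrite eq_sym -mulmxA => /P_orth ->; rewrite mulmx0.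
Qed.

Let emb_diag_mem i X : X \in D i -> @emb i i X \in A.
Proof.
move=> DX; apply/memA; split=> [j|j k lt_kj].
  have [-> | neq_ji] := eqVneq j i; first by rewrite emb_blk.
  by rewrite emb_blk0 ?neq_ji // mem0v.
rewrite emb_blk0 //; apply/orP.
by have [eq_j | ] := eqVneq j i; [right; rewrite -eq_j -val_eqE ltn_eqF | left].
Qed.

Let emb_lt_mem (i j : 'I_q) X : (i < j)%N -> @emb i j X \in A.
Proof.
move=> lt_ij; apply/memA; split=> [k|k l lt_lk].
  rewrite emb_blk0 ?mem0v //; apply/orP.
  by have [eq_k | ] := eqVneq k i; [right; rewrite eq_k -val_eqE ltn_eqF | left].
rewrite emb_blk0 //; apply/orP.
have [eq_k | ] := eqVneq k i; [right | by left].
by rewrite -val_eqE ltn_eqF // (ltn_trans lt_lk) // eq_k.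
Qed.

Let emb_comm (i j : 'I_q) X : (i < j)%N -> exists u v : subvs_of A,
  vsval (subalg_mul u v - subalg_mul v u) = @emb i j X.
Proof.
(* The idempotent of block [i] fixes [emb X] from the left and kills it from the right. *)
move=> lt_ij; exists (Subvs (emb_diag_mem (subalg1 (D i)))).
exists (Subvs (emb_lt_mem X lt_ij)); rewrite /= /emb.
rewrite !mulmx1 !mulmxA -(mulmxA _ (P i) (P i)^T) P_unit mulmx1.
rewrite -(mulmxA _ (P j)) P_orth ?mulmx0 ?mul0mx ?subr0 //.
by rewrite eq_sym -val_eqE ltn_eqF.
Qed.

(** Diagonal blocks commute, so each commutator is strictly block upper triangular and shifts the
    support by one more block diagonal. *)
Let comm_prod_upper k (x : subvs_of A) : comm_prod k x ->
  forall i j : 'I_q, (j < i + k)%N -> submxblock (vsval x) i j = 0.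
Proof.
elim: k x / => [|k x u v _ IH] i j.
  by rewrite addn0; apply: ((memA 1%:M).1 (subalg1 A)).2.
move=> lt_ji; rewrite /= blkM big1 // => l _.
have [lt_li | le_il] := ltnP l (i + k); first by rewrite IH ?mul0mx.
suff -> : submxblock (vsval u *m vsval v - vsval v *m vsval u) l j = 0.
  by rewrite mulmx0.
have le_jl : (j <= l)%N by rewrite (leq_trans _ le_il) // -ltnS -addnS.
have [Du u0] := (memA _).1 (subvsP u); have [Dv v0] := (memA _).1 (subvsP v).
have tri (a b : 'M[K]_(\sum_i d i)) :
    (forall i j : 'I_q, (j < i)%N -> submxblock a i j = 0) ->
    (forall i j : 'I_q, (j < i)%N -> submxblock b i j = 0) ->
    submxblock (a *m b) l j =
      if l == j then submxblock a l l *m submxblock b l j else 0.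
  move=> a0 b0; rewrite blkM; case: eqP => [eq_lj|/eqP neq_lj].
    rewrite (bigD1 l) //= big1 ?addr0 // => m neq_ml.
    have [lt_ml | le_lm] := ltnP m l; first by rewrite a0 ?mul0mx.
    by rewrite b0 ?mulmx0 // -eq_lj ltn_neqAle eq_sym val_eqE neq_ml.
  rewrite big1 // => m _.
  have [lt_ml | le_lm] := ltnP m l; first by rewrite a0 ?mul0mx.
  rewrite b0 ?mulmx0 // (leq_trans _ le_lm) // ltn_neqAle le_jl andbT.
  by rewrite eq_sym val_eqE.
rewrite submxblockB !tri //; case: eqP => [<-|]; last by rewrite subr0.
by rewrite (commD (Du l) (Dv l)) subrr.
Qed.

Let delta11 : delta_mx 0 0 = 1%:M :> 'M[K]_1.
Proof. by apply/matrixP => r c; rewrite !mxE !ord1. Qed.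

(** Walk from block 0 to block [i], one commutator per step. From a unit row [e] in block [j], the
    commutator with block [e^T *m w] leads to [w], since [e *m e^T] is 1; [d_gt0] supplies [e]. *)
Let row_reach (k : nat) (i : 'I_q) (w : 'rV[K]_(d i)) : k = i :> nat ->
  exists x : subvs_of A, exists2 z : 'rV_(\sum_i d i),
    comm_prod k x & z *m vsval x = w *m P i.
Proof.
elim: k i w => [|k IH] i w def_i.
  exists (subalg_one A); exists (w *m P i); first exact: comm_prod0.
  by rewrite mulmx1.
have lt_kq : (k < q)%N by rewrite (leq_trans _ (ltn_ord i)) // -def_i ltnW.
pose j := Ordinal lt_kq; pose e : 'rV[K]_(d j) := delta_mx 0 (Ordinal (d_gt0 j)).
have [x [z cx zx]] := IH j e erefl.
have [u [v def_uv]] : exists u v : subvs_of A,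
    vsval (subalg_mul u v - subalg_mul v u) = @emb j i (e^T *m w).
  by apply: emb_comm; rewrite /= -def_i.
exists (subalg_mul x (subalg_mul u v - subalg_mul v u)); exists z.
  exact: comm_prodS.
rewrite [vsval _]/= -[_ - _]/(vsval (subalg_mul u v - subalg_mul v u)) def_uv.
rewrite mulmxA zx /emb !mulmxA -(mulmxA _ (P j)) P_unit mulmx1.
by rewrite trmx_delta mul_delta_mx delta11 mul1mx.
Qed.

(** Mirror image of [row_reach], walking back from the last block. *)
Let col_reach k (i : 'I_q) (w : 'cV[K]_(d i)) : (i + k = q.-1)%N ->
  exists x : subvs_of A, exists2 z : 'cV_(\sum_i d i),
    comm_prod k x & vsval x *m z = (P i)^T *m w.
Proof.
elim: k i w => [|k IH] i w def_i.
  exists (subalg_one A); exists ((P i)^T *m w); first exact: comm_prod0.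
  by rewrite mul1mx.
have lt_kq : (i.+1 < q)%N.
  by rewrite -ltn_predRL -def_i addnS ltnS leq_addr.
pose j := Ordinal lt_kq; pose e : 'cV[K]_(d j) := delta_mx (Ordinal (d_gt0 j)) 0.
have [|x [z cx zx]] := IH j e; first by rewrite /= addSnnS.
have [u [v def_uv]] : exists u v : subvs_of A,
    vsval (subalg_mul u v - subalg_mul v u) = @emb i j (w *m e^T).
  exact: emb_comm.
exists (subalg_mul (subalg_mul u v - subalg_mul v u) x); exists z.
  exact: comm_prodSl.
rewrite [vsval _]/= -[_ - _]/(vsval (subalg_mul u v - subalg_mul v u)) def_uv.
rewrite -mulmxA zx /emb !mulmxA -(mulmxA _ (P j)) P_unit mulmx1.
by rewrite -(mulmxA _ _ e) trmx_delta mul_delta_mx delta11 mulmx1.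
Qed.

Lemma diag_block_kills i (a : subvs_of A) :
  submxblock (vsval a) i i = 0 <-> comm_prod_kills i (q.-1 - i) a.
Proof.
have le_iq : (i <= q.-1)%N by rewrite -ltnS (ltn_predK (ltn_ord i)).
split=> [a0 x y cx cy | kill].
  apply/val_inj/mxblockP => j l; rewrite submxblock0 blkM big1 // => m _.
  (* A nonzero term [x_jk a_km y_ml] needs [i <= k] from [x], [k <= m] from [a] and [m <= i] from
     [y], so [k = m = i]. *)
  have [lt_lm | le_ml] := ltnP l (m + (q.-1 - i)).
    by rewrite (comm_prod_upper cy) ?mulmx0.
  rewrite blkM big1 ?mul0mx // => k _.
  have [lt_kj | le_jk] := ltnP k (j + i).
    by rewrite (comm_prod_upper cx) ?mul0mx.
  have le_mi : (m <= i)%N.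
    rewrite -(leq_add2r (q.-1 - i)) (subnKC le_iq) (leq_trans le_ml) //.
    by rewrite -ltnS (ltn_predK (ltn_ord i)).
  have le_ik : (i <= k)%N by rewrite (leq_trans _ le_jk) ?leq_addl.
  have [lt_mk | le_km] := ltnP m k.
    by have [_ ->] := (memA _).1 (subvsP a); rewrite ?mulmx0.
  have -> : k = i by apply/val_inj/eqP; rewrite eqn_leq le_ik (leq_trans le_km).
  have -> : m = i.
    by apply/val_inj/eqP; rewrite eqn_leq le_mi (leq_trans le_ik).
  by rewrite a0 mulmx0.
apply/matrixP => r c; rewrite [RHS]mxE.
(* Conversely, [z] and [z'] are chosen so that [z x a y z'] is the entry [(r, c)] of the diagonal
   block. *)
have [x [z cx zx]] := row_reach (delta_mx 0 r) (erefl (val i)).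
have [y [z' cy zy]] := col_reach (delta_mx c 0) (subnKC le_iq).
have /(congr1 (fun u => z *m vsval u *m z')) := kill x y cx cy.
rewrite /= mulmx0 mul0mx !mulmxA zx -!mulmxA zy !mulmxA.
rewrite -(mulmxA _ (P i)) -(mulmxA _ _ (P i)^T) -blkE -rowE -colE.
by move=> /matrixP/(_ 0 0); rewrite !mxE.
Qed.

Lemma diag_block_split_quotient i : split_quotient A (D i) i (q.-1 - i).
Proof.
pose p (a : subvs_of A) : subvs_of (D i) :=
  Subvs (((memA _).1 (subvsP a)).1 i).
pose s (X : subvs_of (D i)) : subvs_of A := Subvs (emb_diag_mem (subvsP X)).
have pL : linear p.
  by move=> c u v; apply/val_inj; rewrite /= !blkE mulmxDr mulmxDl
    -scalemxAr -scalemxAl.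
have sL : linear s.
  by move=> c u v; apply/val_inj; rewrite /= /emb mulmxDr mulmxDl
    -scalemxAr -scalemxAl.
pose pL' := GRing.isLinear.Build K (subvs_of A) (subvs_of (D i)) *:%R p pL.
pose sL' := GRing.isLinear.Build K (subvs_of (D i)) (subvs_of A) *:%R s sL.
exists (HB.pack_for {linear subvs_of A -> subvs_of (D i)} p pL').
exists (HB.pack_for {linear subvs_of (D i) -> subvs_of A} s sL').
split=> [X||u v|u v|a] /=.
- by apply/val_inj; rewrite /= emb_blk.
- by apply/val_inj; rewrite /= blkE mulmx1 P_unit.
(* For [j] other than [i], one of the blocks [(i, j)], [(j, i)] lies below the diagonal. *)
- apply/val_inj; rewrite /= blkM (bigD1 i) //= [X in _ + X]big1 ?addr0 // => j neq_ji.
  have [_ u0] := (memA _).1 (subvsP u); have [_ v0] := (memA _).1 (subvsP v).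
  have [lt_ij | lt_ji | /val_inj eq_ij] := ltngtP i j.
  + by rewrite v0 ?mulmx0.
  + by rewrite u0 ?mul0mx.
  + by rewrite eq_ij eqxx in neq_ji.
- apply/val_inj; rewrite /= /emb !mulmxA.
  by rewrite -(mulmxA _ (P i) (P i)^T) P_unit mulmx1.
- apply: (iff_trans _ (diag_block_kills i a)); split=> [/(congr1 vsval) // | a0].
  exact/val_inj.
Qed.

End BlockTriangular.

Lemma type_split_quotient (K : fieldType) n q (t : q.-tuple nat)
    (A : subalg K n) (D : forall i : 'I_q, subalg K (tnth t i)) i :
  subalg_of_type A D -> (forall i, comm_subalg (D i)) ->
  split_quotient A (D i) i (q.-1 - i).
Proof.
(* Once [n] is the sum itself, the cast reduces to the identity. *)
move=> [t_gt0 [e memA]] commD; subst n.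
exact: (diag_block_split_quotient (D := D)).
Qed.

Theorem theorem6p2 (K : fieldType) (n q : nat) (hq : (2 <= q)%N)
    (t l : q.-tuple nat) (A B : subalg K n)
    (DA : forall i : 'I_q, subalg K (tnth t i))
    (DB : forall i : 'I_q, subalg K (tnth l i))
    (hA : Dq_subalg_of_type_max_dim_db A DA)
    (hB : Dq_subalg_of_type_max_dim_db B DB)
    (hAB : alg_isomorphic A B) :
  t = l /\ forall i : 'I_q, alg_isomorphic (DA i) (DB i).
Proof.
move: hA hB => [typeA maxA] [typeB maxB].
(* The pair [(i, q.-1 - i)] depends on [q] and [i] alone, so the same ideal serves both types before
   their sizes are compared. *)
have isoD i : alg_isomorphic (DA i) (DB i).
  apply: (split_quotient_iso (i := i) (j := q.-1 - i) hAB).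
    by apply: type_split_quotient => // j; have [] := maxA j.
  by apply: type_split_quotient => // j; have [] := maxB j.
split=> //; apply: eq_from_tnth => i.
exact: max_dim_comm_subalg_size (maxA i) (maxB i) (alg_isomorphic_dim (isoD i)).
Qed.
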